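(* Let $X$ be an absolutely continuous real random variable with max-score function $\Theta_X$, and let $Y$ be a Gumbel random variable with parameters $\mu\in\mathbb{R}$ and $\beta>0$. Then the relative entropy from $X$ to $Y$ can be written as $$D(X\|Y) = \left(\mathbb{E}\,\Theta_X(X) + \log\beta + \frac{\mathbb{E}X - \mu}{\beta}\right) + \left(\mathbb{E}\,e^{-(X-\mu)/\beta} - 1\right),$$ assuming both sides of the expression are finite.
   Context: For an absolutely continuous real random variable $X$ with distribution function $F_X(x)=\mathbb{P}(X\le x)$ and density $f_X = F_X'$, the max-score function is $\Theta_X(x) := \log\left(f_X(x)/F_X(x)\right)$. A Gumbel random variable $Y$ with parameters $\mu$ and $\beta$ has distribution function $F_Y(y) = \exp\left(-e^{-(y-\mu)/\beta}\right)$, $y\in\mathbb{R}$. The relative entropy is $D(X\|Y) = \int f_X(x)\log\left(f_X(x)/f_Y(x)\right)dx$, where $f_Y$ is the density of $Y$. Logarithms are natural. *)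

(* Defs.v *)
From HB Require Import structures.
From mathcomp Require Import all_boot all_order all_algebra.
From mathcomp Require Import all_classical all_reals all_analysis.

Set Implicit Arguments.
Unset Strict Implicit.
Unset Printing Implicit Defensive.

Import Order.TTheory GRing.Theory Num.Theory.
Import numFieldNormedType.Exports.

Local Open Scope classical_set_scope.
Local Open Scope ring_scope.
Local Open Scope ereal_scope.

Definition absolutely_continuous_rv (d : measure_display) (T : measurableType d)
    (R : realType) (P : probability T R) (X : {RV P >-> R}) : Prop :=
  distribution P X `<< (@lebesgue_measure R).

Definition rcdf (d : measure_display) (T : measurableType d)
    (R : realType) (P : probability T R) (X : {RV P >-> R}) (x : R) : R :=
  fine (cdf X x).

(* For an absolutely continuous X the derivative of the distribution function
   exists Lebesgue-a.e.; at the remaining points the value is arbitrary. *)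
Definition density (d : measure_display) (T : measurableType d)
    (R : realType) (P : probability T R) (X : {RV P >-> R}) : R -> R :=
  (rcdf X)^`()%classic.

(* [lne] is the logarithm with log 0 = -oo, whereas [ln 0 = 0]. The value -oo is
   taken where the density vanishes, i.e. on an event of probability zero. *)
Definition max_score (d : measure_display) (T : measurableType d)
    (R : realType) (P : probability T R) (X : {RV P >-> R}) (x : R) : \bar R :=
  lne ((density X x)%:E / (rcdf X x)%:E).

Definition gumbel_rv (d : measure_display) (T : measurableType d)
    (R : realType) (P : probability T R) (Y : {RV P >-> R})
    (mu beta : R) : Prop :=
  forall y : R, cdf Y y = (expR (- expR (- ((y - mu) / beta))))%:E.

(* In [\bar R], 0 * (-oo) = 0 and r / 0 = +oo for r > 0, so this follows the
   usual conventions 0 log 0 = 0 and r log (r / 0) = +oo. *)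
Definition relative_entropy (R : realType)
    (d : measure_display) (T : measurableType d) (P : probability T R)
    (d' : measure_display) (T' : measurableType d') (Q : probability T' R)
    (X : {RV P >-> R}) (Y : {RV Q >-> R}) : \bar R :=
  \int[@lebesgue_measure R]_x
    ((density X x)%:E * lne ((density X x)%:E / (density Y x)%:E)).

(* Expectation of g(X) for an extended-real-valued g ('E_P is for
   real-valued functions only). *)
Definition expectation_of (d : measure_display) (T : measurableType d)
    (R : realType) (P : probability T R) (X : {RV P >-> R})
    (g : R -> \bar R) : \bar R :=
  \int[P]_w g (X w).

(* Main.v *)
Require Import Defs.
From HB Require Import structures.
From mathcomp Require Import all_boot all_order all_algebra.
From mathcomp Require Import all_classical all_reals all_analysis.
From mathcomp Require Import measurable_realfun ring.

Import Order.TTheory GRing.Theory Num.Theory.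
Import numFieldNormedType.Exports.

Local Open Scope classical_set_scope.
Local Open Scope ring_scope.
Local Open Scope ereal_scope.

(** Let f and F be the density and the distribution function of X. With
    z = (x - mu) / beta, the Gumbel density is g = exp(-z) exp(-exp(-z)) / beta,
    so that - ln g = ln beta + z + exp(-z), and
      D(X || Y) = E[ln f(X)] + ln beta + (E[X] - mu) / beta + E[exp(-Z)]
    where Z = (X - mu) / beta ([relative_entropy_gumbel]). On the other side
    the max-score is ln f - ln F, so the two sides differ by E[ln F(X)] + 1.
    Since F is continuous, F(X) is uniformly distributed on [0, 1]
    ([prob_rcdf_lt]); hence - ln F(X) is exponentially distributed with mean 1
    ([integral_ln_rcdf]) and that difference vanishes. Finiteness of the
    right-hand side makes the max-score of X, X and exp(-Z) integrable, which is
    what splitting the expectations requires.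

    The density is a derivative of F that exists only almost everywhere, so the
    computations are made with a Radon-Nikodym derivative of the law of X
    instead. The two agree almost everywhere by Lebesgue's differentiation
    theorem ([density_ae]), and modifying an integrand on a null set is harmless
    even when its measurability is unknown ([ae_eq_integralT]). *)

Set Implicit Arguments.
Unset Strict Implicit.

(** * Integrals and null sets *)

Section ae_integral.
Context {d : measure_display} {T : measurableType d} {R : realType}
  (m : {measure set T -> \bar R}).

Import HBNNSimple.

(** The integral of a nonnegative function is the supremum of the integrals of
    the measurable simple functions below it, and cutting off such a simple
    function on a measurable null set does not change its integral. So the
    argument also covers a density of which only an almost everywhere equal
    version is known to be measurable. *)
Lemma ge0_ae_le_integralT (f g : T -> \bar R) :
  (forall x, 0 <= f x) -> (forall x, 0 <= g x) ->
  {ae m, forall x, f x <= g x} -> \int[m]_x f x <= \int[m]_x g x.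
Proof.
move=> f0 g0 [N [mN N0 subN]].
rewrite ge0_integralTE//; apply: ge_ereal_sup => _ [h hf <-].
have mNC : measurable (~` N) by exact: measurableC.
have -> : sintegral m h = sintegral m (proj_nnsfun h mNC).
  rewrite -integralT_nnsfun (ge0_negligible_integral mN)//; last 2 first.
  - exact/measurable_EFinP.
  - by move=> x _; rewrite lee_fin.
  by rewrite setTD integral_nnsfun// mrestrict.
rewrite ge0_integralTE//; apply: ereal_sup_ubound.
exists (proj_nnsfun h mNC) => // x /=.
rewrite mindicE; have [xN|xN] := boolP (x \in ~` N); last by rewrite mulr0.
rewrite mulr1; apply: le_trans (hf x) _.
by apply: contrapT => fg; move: xN; rewrite inE; apply; exact: subN.
Qed.

Lemma ae_eq_integralT (f g : T -> \bar R) :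
  {ae m, forall x, f x = g x} -> \int[m]_x f x = \int[m]_x g x.
Proof.
have le u v : {ae m, forall x, u x = v x} ->
    \int[m]_x u^\+ x <= \int[m]_x v^\+ x /\ \int[m]_x u^\- x <= \int[m]_x v^\- x.
  by move=> uv; split; apply: ge0_ae_le_integralT => //;
    apply: filterS uv => x; rewrite !(funeposE, funenegE) => ->.
move=> fg; have [pfg nfg] := le _ _ fg.
have [|pgf ngf] := le g f; first by apply: filterS fg.
rewrite integralE [RHS]integralE; congr (_ - _);
  by apply/eqP; rewrite eq_le ?pfg ?pgf ?nfg ?ngf.
Qed.

(** The integral is the difference of those of the positive and negative parts,
    so it can be finite only if both are. *)
Lemma integrable_integral_fin_num (f : T -> R) :
  measurable_fun setT f -> \int[m]_x (f x)%:E \is a fin_num ->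
  m.-integrable setT (EFin \o f).
Proof.
move=> mf fin; apply/integrableP; split; first exact/measurable_EFinP.
by rewrite integral_fin_num_abs.
Qed.

End ae_integral.

(** * Radon-Nikodym density of an absolutely continuous random variable *)

Section absolutely_continuous_rv.
Context {d : measure_display} {T : measurableType d} {R : realType}
  {P : probability T R} (X : {RV P >-> R}) (hX : absolutely_continuous_rv X).

Local Notation lambda := (@lebesgue_measure R).

Lemma measurable_borel_rv :
  measurable_fun (setT : set T) (X : T -> measurableTypeR R).
Proof. by have := measurable_funPT X. Qed.

(** The same function as X; only the measurable structure declared on the reals
    changes, to the one that carries the Lebesgue measure. The law of X and the
    Lebesgue measure can then be compared by Radon-Nikodym. *)
Definition borel_rv : {RV P >-> measurableTypeR R} :=
  HB.pack_for {RV P >-> measurableTypeR R} (X : T -> measurableTypeR R)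
    (isMeasurableFun.Build _ _ T (measurableTypeR R) _ measurable_borel_rv).

Local Notation PX := (distribution P borel_rv).

Let PX_lambda : PX `<< lambda.
Proof. exact: hX. Qed.

Definition rn_density (x : R) : R :=
  fine (Radon_Nikodym_SigmaFinite.f PX lambda x).

Lemma rn_density_ge0 (x : R) : (0 <= rn_density x)%R.
Proof. by rewrite fine_ge0// Radon_Nikodym_SigmaFinite.f_ge0. Qed.

Lemma EFin_rn_density :
  EFin \o rn_density = Radon_Nikodym_SigmaFinite.f PX lambda.
Proof.
by apply/funext => x/=; rewrite fineK// Radon_Nikodym_SigmaFinite.f_fin_num.
Qed.

Lemma integrable_rn_density : lambda.-integrable setT (EFin \o rn_density).
Proof. by rewrite EFin_rn_density; exact: Radon_Nikodym_SigmaFinite.f_integrable. Qed.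

Lemma measurable_rn_density : measurable_fun setT rn_density.
Proof. by have /integrableP[/measurable_EFinP] := integrable_rn_density. Qed.

Lemma integral_rn_density (A : set R) : measurable A ->
  \int[lambda]_(x in A) (rn_density x)%:E = distribution P X A.
Proof.
move=> mA; transitivity (PX A) => //.
rewrite (Radon_Nikodym_SigmaFinite.f_integral PX_lambda mA).
by apply: eq_integral => x _; rewrite -EFin_rn_density.
Qed.

(** The change of variables for nonnegative functions applies to the positive
    and negative parts separately, because multiplying by a nonnegative density
    commutes with taking either part. *)
Lemma integral_rn_density_comp (h : R -> \bar R) : measurable_fun setT h ->
  \int[lambda]_x (h x * (rn_density x)%:E) = \int[P]_w h (X w).
Proof.
have ge0 (u : R -> \bar R) : measurable_fun setT u -> (forall x, 0 <= u x) ->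
    \int[lambda]_x (u x * (rn_density x)%:E) = \int[P]_w u (X w).
  move=> mu u0; transitivity (\int[PX]_x u x).
    rewrite -(Radon_Nikodym_SigmaFinite.change_of_variables PX_lambda u0)//.
    by apply: eq_integral => x _; rewrite -EFin_rn_density.
  by rewrite ge0_integral_distribution.
move=> mh; rewrite integralE [RHS]integralE; congr (_ - _).
- transitivity (\int[P]_w h^\+ (X w)); last first.
    by apply: eq_integral => w _; rewrite !funeposE.
  rewrite -ge0//; last exact: measurable_funepos.
  apply: eq_integral => x _.
  by rewrite !funeposE maxe_pMl ?mul0e ?lee_fin ?rn_density_ge0.
- transitivity (\int[P]_w h^\- (X w)); last first.
    by apply: eq_integral => w _; rewrite !funenegE.
  rewrite -ge0//; last exact: measurable_funeneg.
  apply: eq_integral => x _.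
  by rewrite !funenegE maxe_pMl ?mul0e ?mulNe ?lee_fin ?rn_density_ge0.
Qed.

Lemma ae_comp_rv (A : R -> Prop) :
  {ae lambda, forall x, A x} -> {ae P, forall w, A (X w)}.
Proof.
move=> [N [mN N0 AN]]; exists (X @^-1` N); split.
- by have := measurable_funPTI X mN.
- transitivity (distribution P X N) => //; rewrite -integral_rn_density//.
  apply: null_set_integral => //; apply: (measurable_int lambda).
  exact: (integrableS measurableT mN (@subsetT _ N) integrable_rn_density).
- by move=> w /= Aw; apply: AN.
Qed.

Lemma rn_density_gt0_ae : {ae P, forall w, (0 < rn_density (X w))%R}.
Proof.
pose N := rn_density @^-1` [set 0%R].
have mN : measurable N.
  by rewrite -[N]setTI; exact: measurable_rn_density.
exists (X @^-1` N); split.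
- by have := measurable_funPTI X mN.
- transitivity (distribution P X N) => //; rewrite -integral_rn_density//.
  by apply: integral0_eq => x ->.
- move=> w /=; rewrite lt_def rn_density_ge0 andbT => /negP.
  by rewrite negbK => /eqP.
Qed.

(** The distribution function is the indefinite integral of the Radon-Nikodym
    density, so Lebesgue's differentiation theorem gives its derivative. *)
Lemma density_ae : {ae lambda, forall x, density X x = rn_density x}.
Proof.
have intN y : lambda.-integrable `]-oo, y] (EFin \o rn_density).
  by apply: integrableS integrable_rn_density.
have loc : locally_integrable [set: R] rn_density.
  exact: (open_integrable_locally openT integrable_rn_density).
have := FTC1Ny intN loc; rewrite /density.
rewrite (_ : (fun x : R => _) = rcdf X); last first.
  by apply/funext => x; rewrite /Rintegral integral_rn_density.
by apply: (@filterS _ _ (ae_filter_ringOfSetsType lambda)) => x [].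
Qed.

(** * The probability integral transform *)

Lemma EFin_rcdf (x : R) : (rcdf X x)%:E = cdf X x.
Proof. by rewrite /rcdf fineK// fin_num_measure. Qed.

Lemma rcdf_le1 (x : R) : (rcdf X x <= 1)%R.
Proof. by rewrite -lee_fin EFin_rcdf cdf_le1. Qed.

Lemma le_rcdf : {homo rcdf X : x y / (x <= y)%R}.
Proof. by move=> x y xy; rewrite -lee_fin !EFin_rcdf cdf_nondecreasing. Qed.

Lemma measurable_rcdf : measurable_fun setT (rcdf X).
Proof. by apply: measurableT_comp => //; exact: cdf_measurable. Qed.

(** On [a, b] the increment F(x) - F(a) is the integral of the Radon-Nikodym
    density over [a, x], a continuous function of x. *)
Lemma rcdf_within_continuous (a b : R) : (a <= b)%R ->
  {within `[a, b], continuous (rcdf X)}.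
Proof.
move=> ab.
have int (i : interval R) : lambda.-integrable [set` i] (EFin \o rn_density).
  by apply: integrableS integrable_rn_density.
have c := @parameterized_integral_continuous R a b rn_density ab (int _).
have : {within `[a, b], continuous
    (fun x => rcdf X a + parameterized_integral lambda a x rn_density)%R}.
  by move=> x; apply: cvgD; [exact: cvg_cst|exact: c].
apply: subspace_eq_continuous => x; rewrite inE/= in_itv/= => /andP[ax _].
change (rcdf X a + \int[lambda]_(t in `[a, x]) rn_density t = rcdf X x)%R.
rewrite -Rintegral_itv_obnd_cbnd//.
rewrite -(@Rintegral_itvB _ _ -oo%O)//.
by rewrite /Rintegral !integral_rn_density//= addrC subrK.
Qed.

Lemma rcdf_attains (u : R) : (0 < u < 1)%R -> exists a, rcdf X a = u.
Proof.
move=> /andP[u0 u1].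
have [a au] : exists a, (rcdf X a < u)%R.
  have /cvgr_lt/(_ _ u0) : rcdf X x @[x --> -oo%R] --> (0:R)%R.
    by apply: fine_cvg; exact: cvg_cdfNy0.
  by move=> /filter_ex.
have [b ub] : exists b, (u < rcdf X b)%R.
  have /cvgr_gt/(_ _ u1) : rcdf X x @[x --> +oo%R] --> (1:R)%R.
    by apply: fine_cvg; exact: cvg_cdfy1.
  by move=> /filter_ex.
have ab : (a <= b)%R.
  rewrite leNgt; apply/negP => /ltW/le_rcdf; apply/negP.
  by rewrite -ltNge (lt_trans au).
have [|c _ cu] := @IVT R _ a b u ab (rcdf_within_continuous ab).
  by rewrite ge_min le_max (ltW au) (ltW ub) orbT.
by exists c.
Qed.

Lemma measurable_rcdf_rv : measurable_fun setT (fun w => rcdf X (X w)).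
Proof. by apply: (measurableT_comp measurable_rcdf); exact: measurable_funPT. Qed.

Lemma measurable_rcdf_lt (u : R) : measurable [set w | (rcdf X (X w) < u)%R].
Proof.
have := measurable_rcdf_rv measurableT (measurable_itv `]-oo, u[).
by rewrite setTI.
Qed.

Lemma measurable_rcdf_le (u : R) : measurable [set w | (rcdf X (X w) <= u)%R].
Proof.
have := measurable_rcdf_rv measurableT (measurable_itv `]-oo, u]).
by rewrite setTI.
Qed.

(** Uniformity of F(X). If F(a) = v then [F(X) < v] implies X <= a, which implies
    [F(X) <= v]; as X <= a has probability F(a) = v, this gives
    P(F(X) < v) <= v <= P(F(X) <= v). Letting v increase to u in the second
    inequality turns <= into <, without any discussion of the intervals on which
    F is constant. *)
Lemma prob_rcdf_lt (u : R) : (0 < u <= 1)%R ->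
  P [set w | (rcdf X (X w) < u)%R] = u%:E.
Proof.
have mX a : measurable (X @^-1` `]-oo, a]).
  by have := measurable_funPTI X (measurable_itv `]-oo, a]).
have le_prob v : (0 < v < 1)%R -> P [set w | (rcdf X (X w) < v)%R] <= v%:E.
  move=> /rcdf_attains[a <-].
  rewrite EFin_rcdf; change (cdf X a) with (P (X @^-1` `]-oo, a])).
  apply: le_measure; rewrite ?inE//.
    exact: measurable_rcdf_lt.
  move=> w /=; rewrite in_itv/= leNgt => Fw; apply/negP => /ltW/le_rcdf.
  by apply/negP; rewrite -ltNge.
have ge_prob v : (0 < v < 1)%R -> v%:E <= P [set w | (rcdf X (X w) <= v)%R].
  move=> /rcdf_attains[a <-].
  rewrite EFin_rcdf; change (cdf X a) with (P (X @^-1` `]-oo, a])).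
  apply: le_measure; rewrite ?inE//.
    exact: measurable_rcdf_le.
  by move=> w /=; rewrite in_itv/=; exact: le_rcdf.
move=> /andP[u0 u1]; apply/eqP; rewrite eq_le; apply/andP; split.
  have [->|un1] := eqVneq u 1%R.
    exact: (probability_le1 P (measurable_rcdf_lt _)).
  by rewrite le_prob// u0 lt_neqAle un1.
apply/lee_addgt0Pr => e e0.
(* u - e may be nonpositive; u / 2 keeps v inside the open unit interval *)
pose v := Num.max (u - e)%R (u / 2)%R.
have vu : (v < u)%R.
  by rewrite gt_max ltrBlDr ltrDl e0 gtr_pMr// invf_lt1 ?ltr1n.
have v01 : (0 < v < 1)%R.
  by rewrite (lt_le_trans vu u1) andbT lt_max divr_gt0 ?orbT.
have uv : (u <= v + e)%R by rewrite -lerBlDr le_max lexx.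
rewrite (@le_trans _ _ (v%:E + e%:E))//.
rewrite leeD2r// (le_trans (ge_prob v v01))// le_measure ?inE//.
- exact: measurable_rcdf_le.
- exact: measurable_rcdf_lt.
- by move=> w /= /le_lt_trans; apply.
Qed.

Lemma rcdf_gt0_ae : {ae P, forall w, (0 < rcdf X (X w))%R}.
Proof.
exists [set w | (rcdf X (X w) <= 0)%R]; split.
- exact: measurable_rcdf_le.
- apply/eqP; rewrite eq_le measure_ge0 andbT; apply/lee_addgt0Pr => e e0.
  have u01 : (0 < Num.min e 1 <= 1)%R.
    by rewrite lt_min e0 ltr01 ge_min lexx orbT.
  rewrite add0e (@le_trans _ _ (Num.min e 1)%:E)//; last first.
    by rewrite lee_fin ge_min lexx.
  rewrite -(prob_rcdf_lt u01) le_measure ?inE//.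
  + exact: measurable_rcdf_le.
  + exact: measurable_rcdf_lt.
  + by move=> w /= /le_lt_trans; apply; case/andP: u01.
- by move=> w /= /negP; rewrite -leNgt.
Qed.

Lemma measurable_ln_rcdf :
  measurable_fun setT (fun w => - ln (rcdf X (X w)))%R.
Proof.
apply: measurableT_comp => //; apply: measurableT_comp => //.
exact: measurable_rcdf_rv.
Qed.

(** The tail formula reduces the mean of - ln F(X) to the integral over r >= 0 of
    P(- ln F(X) > r) = P(F(X) < exp(-r)) = exp(-r), that is, to the total mass of
    the exponential distribution with rate 1. *)
Lemma integral_ln_rcdf : \int[P]_w (- ln (rcdf X (X w)))%:E = 1.
Proof.
pose Z : {RV P >-> R} :=
  HB.pack_for {RV P >-> R} (fun w => - ln (rcdf X (X w)))%R
    (isMeasurableFun.Build _ _ _ _ _ measurable_ln_rcdf).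
have Z0 w : (0 <= Z w)%R by rewrite oppr_ge0 ln_le0// rcdf_le1.
have := ge0_expectation_ccdf Z0; rewrite expectation_def => ->.
rewrite -(integral_exponential_pdf (@ltr01 R)) [LHS]integral_mkcond.
apply: eq_integral => r _; rewrite /exponential_pdf !patchE.
case: ifPn => //; rewrite inE/= in_itv/= andbT => r0.
rewrite mul1r mulN1r.
have u01 : (0 < expR (- r) <= 1)%R by rewrite expR_gt0 -expR0 ler_expR oppr_le0.
rewrite -(prob_rcdf_lt u01).
change (ccdf Z r) with (P (Z @^-1` `]r, +oo[)).
have mZ : measurable (Z @^-1` `]r, +oo[).
  by have := measurable_funPTI Z (measurable_itv `]r, +oo[).
have mF := measurable_rcdf_lt (expR (- r)).
apply/eqP; rewrite eq_le; apply/andP; split.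
  apply: le_measure; rewrite ?inE// => w /=; rewrite in_itv/= andbT => rZ.
  have [F0|F0] := ltP 0%R (rcdf X (X w)).
    by rewrite -[ltLHS]lnK ?posrE// ltr_expR ltrNr.
  by rewrite (le_lt_trans F0)// expR_gt0.
(* where F(X) = 0 the convention ln 0 = 0 puts the point outside [Z > r] *)
have [N [mN N0 FN]] := rcdf_gt0_ae.
rewrite (@le_trans _ _ (P (Z @^-1` `]r, +oo[ `|` N)))//.
  apply: le_measure; rewrite ?inE//; first exact: measurableU.
  move=> w /= Fr; have [F0|F0] := ltP 0%R (rcdf X (X w)).
    by left; rewrite in_itv/= andbT ltrNr -ltr_expR lnK.
  by right; apply: FN => /=; apply/negP; rewrite -leNgt.
by rewrite (le_trans (measureU2 _ mZ mN))// [X in _ + X]N0 adde0.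
Qed.

Lemma expectation_of_max_score :
  expectation_of X (max_score X) =
  \int[P]_w (ln (rn_density (X w)) - ln (rcdf X (X w)))%:E.
Proof.
apply: ae_eq_integralT.
apply: filterS3 (ae_comp_rv density_ae) rn_density_gt0_ae rcdf_gt0_ae.
move=> w fE f0 F0; rewrite /max_score fE inver gt_eqF//.
by rewrite -EFinM lne_EFin ?divr_gt0// ln_div.
Qed.

End absolutely_continuous_rv.

(** * Relative entropy to a Gumbel distribution *)

Section gumbel.
Context {d : measure_display} {T : measurableType d} {R : realType}
  {Q : probability T R} (Y : {RV Q >-> R}) (mu beta : R).

Definition gumbel_pdf (x : R) : R :=
  beta^-1 * expR (- ((x - mu) / beta)) * expR (- expR (- ((x - mu) / beta))).

Lemma density_gumbel : gumbel_rv Y mu beta -> density Y =1 gumbel_pdf.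
Proof.
move=> hY x; rewrite /density.
rewrite (_ : rcdf Y = fun y => expR (- expR (- ((y - mu) / beta)))); last first.
  by apply/funext => y; rewrite /rcdf hY.
rewrite derive1E derive_val /gumbel_pdf.
rewrite scaler0 add0r subr0 [_ *: _]mulr1 !mulrN opprK mulrC.
by rewrite [(_ / beta)%R in LHS]mulrC.
Qed.

Lemma gumbel_pdf_gt0 (x : R) : (0 < beta)%R -> (0 < gumbel_pdf x)%R.
Proof. by move=> b0; rewrite !mulr_gt0 ?invr_gt0 ?expR_gt0. Qed.

Lemma ln_gumbel_pdf (x : R) : (0 < beta)%R ->
  ln (gumbel_pdf x) =
  (- (ln beta + (x - mu) / beta + expR (- ((x - mu) / beta))))%R.
Proof.
move=> b0; rewrite /gumbel_pdf !lnM ?posrE ?mulr_gt0 ?invr_gt0 ?expR_gt0//.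
by rewrite lnV ?posrE// !expRK !opprD.
Qed.

End gumbel.

(** At p = 0 the left-hand side is 0 * -oo and the right-hand side is
    (0 - ln g) * 0; both are 0. *)
Lemma mul_lne_div (R : realType) (p g : R) : (0 <= p)%R -> (0 < g)%R ->
  p%:E * lne (p%:E / g%:E) = ((ln p - ln g) * p)%:E.
Proof.
rewrite le_eqVlt => /predU1P[<-|p0] g0; first by rewrite mul0e mulr0.
rewrite inver gt_eqF// -EFinM lne_EFin ?divr_gt0// ln_div ?posrE//.
by rewrite -EFinM mulrC.
Qed.

Lemma relative_entropy_gumbel (R : realType)
    (d : measure_display) (T : measurableType d) (P : probability T R)
    (d' : measure_display) (T' : measurableType d') (Q : probability T' R)
    (X : {RV P >-> R}) (Y : {RV Q >-> R}) (mu beta : R) :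
  absolutely_continuous_rv X -> (0 < beta)%R -> gumbel_rv Y mu beta ->
  relative_entropy X Y = \int[P]_w
    (ln (rn_density X (X w)) +
     (ln beta + (X w - mu) / beta + expR (- ((X w - mu) / beta))))%:E.
Proof.
move=> hX b0 hY; pose h (x : R) : R := (ln (rn_density X x) +
  (ln beta + (x - mu) / beta + expR (- ((x - mu) / beta))))%R.
rewrite -(integral_rn_density_comp hX (h := EFin \o h)).
  apply: ae_eq_integralT.
  apply: (@filterS _ _ (ae_filter_ringOfSetsType (@lebesgue_measure R)))
    (density_ae hX) => x ->.
  rewrite (density_gumbel hY) mul_lne_div ?gumbel_pdf_gt0 ?rn_density_ge0//.
  by rewrite ln_gumbel_pdf// opprK.
have mz : measurable_fun setT (fun x : R => (x - mu) / beta)%R.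
  by apply: measurable_funM => //; exact: measurable_funB.
apply/measurable_EFinP; apply: measurable_funD.
  by apply: measurableT_comp => //; exact: measurable_rn_density.
apply: measurable_funD; first exact: measurable_funD.
by apply: measurableT_comp => //; exact: measurableT_comp.
Qed.

(** In the extended reals a sum is finite only if every term is. *)
Lemma fin_num_terms (R : realType) (t x e : \bar R) (l m b : R) : (0 < b)%R ->
  (t + l%:E + (x - m%:E) / b%:E) + (e - 1) \is a fin_num ->
  [/\ t \is a fin_num, x \is a fin_num & e \is a fin_num].
Proof.
move=> b0; rewrite !fin_numD inver gt_eqF//.
move=> /andP[/andP[/andP[-> _] xmb] /andP[-> _]].
split=> //; case: x xmb => [r| |]//.
  by rewrite addye// gt0_mulye// lte_fin invr_gt0.
by rewrite addNye gt0_mulNye// lte_fin invr_gt0.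
Qed.

Unset Implicit Arguments.
Set Strict Implicit.

Theorem proposition2p4 (R : realType)
    (d : measure_display) (T : measurableType d) (P : probability T R)
    (d' : measure_display) (T' : measurableType d') (Q : probability T' R)
    (X : {RV P >-> R}) (Y : {RV Q >-> R}) (mu beta : R)
    (hX : absolutely_continuous_rv X)
    (hbeta : (0 < beta)%R)
    (hY : gumbel_rv Y mu beta)
    (hD : relative_entropy X Y \is a fin_num)
    (hE : (expectation_of X (max_score X) + (ln beta)%:E
             + ('E_P[X] - mu%:E) / beta%:E)
          + ('E_P[fun w => expR (- ((X w - mu) / beta))%R] - 1)
          \is a fin_num) :
  relative_entropy X Y =
    (expectation_of X (max_score X) + (ln beta)%:E
       + ('E_P[X] - mu%:E) / beta%:E)
    + ('E_P[fun w => expR (- ((X w - mu) / beta))%R] - 1).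
Proof.
pose theta w : R := (ln (rn_density X (X w)) - ln (rcdf X (X w)))%R.
pose e w := expR (- ((X w - mu) / beta)).
have mX : measurable_fun setT X by exact: measurable_funPT.
have mtheta : measurable_fun setT theta.
  apply: measurable_funB; apply: measurableT_comp => //.
    exact: (measurableT_comp (measurable_rn_density hX) mX).
  exact: measurable_rcdf_rv.
have me : measurable_fun setT e.
  apply: measurableT_comp => //; apply: measurableT_comp => //.
  by apply: measurable_funM => //; exact: measurable_funB.
move: hE; rewrite (relative_entropy_gumbel hX hbeta hY).
rewrite expectation_of_max_score// unlock => hE.
have [ftheta fX fe] := fin_num_terms hbeta hE.
rewrite inver gt_eqF//.
have itheta := integrable_integral_fin_num mtheta ftheta.
have iX := integrable_integral_fin_num mX fX.
have ie := integrable_integral_fin_num me fe.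
have iF : P.-integrable setT (fun w => (- ln (rcdf X (X w)))%:E).
  apply: (integrable_integral_fin_num (measurable_ln_rcdf X)).
  by rewrite integral_ln_rcdf.
pose c := (ln beta - mu / beta)%R.
have ic : P.-integrable setT (fun=> c%:E) by exact: finite_measure_integrable_cst.
have iZ := integrableZl measurableT beta^-1 iX.
transitivity (\int[P]_w ((((theta w)%:E - (- ln (rcdf X (X w)))%:E)
   + (c%:E + (beta^-1)%:E * (X w)%:E)) + (e w)%:E)).
  apply: eq_integral => w _.
  rewrite -EFinN -EFinM -!EFinD /theta /c /e; congr (_%:E).
  by field; rewrite gt_eqF.
rewrite integralD//; last first.
  by apply: integrableD => //; [exact: integrableB|exact: integrableD].
rewrite integralD//; [|exact: integrableB|exact: integrableD].
rewrite integralB// integralD// integralZl// integral_ln_rcdf//.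
rewrite integral_cst// [X in _ * X](_ : _ = 1) ?mule1; last first.
  exact: probability_setT.
move: ftheta fX fe; rewrite -/e /theta.
case: (\int[P]_w (theta w)%:E) => // t _.
case: (\int[P]_w (X w)%:E) => // x _.
case: (\int[P]_w (e w)%:E) => // y _.
rewrite -!(EFinN, EFinM, EFinD) /c; congr (_%:E).
by field; rewrite gt_eqF.
Qed.
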